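(* For each integer $n\ge 2$, let $b_n$ be the maximum, over all graphs $G$ on $n$ vertices, of the number of basic balanced measures on $G$, and let $c_n$ be the maximum, over all graphs $G$ on $n$ vertices, of the number of connected components of the space of balanced measures on $G$. Then for every $n\ge 2$, $$2^{\lfloor n/3\rfloor}-1\le b_n\le 2^{2n}-1\qquad\text{and}\qquad 2^{\lfloor n/3\rfloor}-1\le c_n\le 2^{2n}-1.$$
   Context: Every graph $G=(V,E)$ is finite, connected and simple with unit edge weights; $d(u,v)$ is the graph distance. A probability measure on $V$ is identified with a function $\mu:V\to\mathbb{R}_{\ge 0}$ with $\sum_{v\in V}\mu(v)=1$; for $|V|=n$ the set of probability measures is thus identified with the standard $(n-1)$-simplex in $\mathbb{R}^n$, and the space of balanced measures carries the subspace topology. The support is $\operatorname{spt}\mu=\{v\in V:\mu(v)>0\}$. The transport cost function is $T_\mu(v)=\sum_{u\in V}d(u,v)\mu(u)$, and the cost-maximizing set is $M_\mu=\{v\in V: T_\mu(v)=\max_{u\in V}T_\mu(u)\}$. A probability measure $\mu$ is balanced if $\operatorname{spt}\mu\subseteq M_\mu$. A probability measure $\mu$ is basic if for every probability measure $\nu\ne\mu$ on $V$ at least one of $\operatorname{spt}\mu\neq\operatorname{spt}\nu$ or $M_\mu\ne M_\nu$ holds. *)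

(* Defs.v *)
From HB Require Import structures.
From mathcomp Require Import all_boot all_order all_algebra.
From mathcomp Require Import all_classical all_reals all_analysis.
Set Implicit Arguments.
Unset Strict Implicit.
Unset Printing Implicit Defensive.
Import Order.TTheory GRing.Theory Num.Theory.
Import numFieldTopology.Exports numFieldNormedType.Exports.
Local Open Scope classical_set_scope.
Local Open Scope card_scope.
Local Open Scope ring_scope.

Record graph (n : nat) := Graph {
  edge : rel 'I_n;
  edge_sym : symmetric edge;
  edge_irrefl : irreflexive edge;
  edge_connected : forall u v, connect edge u v }.

Section Graph.
Variables (n : nat) (G : graph n).

Definition has_walk (u v : 'I_n) (k : nat) : bool :=
  [exists p : k.-tuple 'I_n, path (edge G) u p && (last u p == v)].

Lemma has_walk_ex (u v : 'I_n) : exists k, has_walk u v k.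
Proof.
have /connectP[p pth ->] := edge_connected G u v.
exists (size p); apply/existsP; exists (in_tuple p).
by rewrite pth eqxx.
Qed.

Definition dist (u v : 'I_n) : nat := ex_minn (has_walk_ex u v).

End Graph.

Section Measures.
Variables (R : realType) (n : nat) (G : graph n).
Implicit Types mu nu : 'rV[R]_n.

Definition prob_measure mu : Prop :=
  (forall v, 0 <= mu ord0 v) /\ \sum_v mu ord0 v = 1.

Definition spt mu : set 'I_n := [set v | 0 < mu ord0 v].

Definition transport_cost mu (v : 'I_n) : R :=
  \sum_u (dist G u v)%:R * mu ord0 u.

Definition cost_maximizers mu : set 'I_n :=
  [set v | forall u, transport_cost mu u <= transport_cost mu v].

Definition balanced mu : Prop :=
  prob_measure mu /\ spt mu `<=` cost_maximizers mu.

Definition basic mu : Prop :=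
  prob_measure mu /\
  forall nu, prob_measure nu -> nu <> mu ->
    spt mu <> spt nu \/ cost_maximizers mu <> cost_maximizers nu.

Definition balanced_measures : set 'rV[R]_n := [set mu | balanced mu].

Definition basic_balanced_measures : set 'rV[R]_n :=
  [set mu | basic mu /\ balanced mu].

(* [connected_component A x] is relative to the subspace topology of [A];
   here [A] sits in R^n with its usual topology. *)
Definition balanced_components : set (set 'rV[R]_n) :=
  [set connected_component balanced_measures mu | mu in balanced_measures].

End Measures.

(* Stated as a relation so that the finiteness of every [A i] is part of the
   claim that the maximum [m] exists, rather than hidden by a default value of
   a total cardinality function. *)
Definition is_max_card (I U : Type) (A : I -> set U) (m : nat) : Prop :=
  (forall i, exists2 k, A i #= `I_k & (k <= m)%N) /\
  (exists i, A i #= `I_m).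

Definition is_b (R : realType) (n b : nat) : Prop :=
  is_max_card (fun G : graph n => @basic_balanced_measures R n G) b.

Definition is_c (R : realType) (n c : nat) : Prop :=
  is_max_card (fun G : graph n => @balanced_components R n G) c.

(* Main.v *)
Require Import Defs.
From mathcomp Require Import all_boot all_order all_algebra.
From mathcomp Require Import all_classical all_reals all_analysis.
From mathcomp Require Import lra ring.
Set Implicit Arguments.
Unset Strict Implicit.
Unset Printing Implicit Defensive.
Import Order.TTheory GRing.Theory Num.Theory.
Import numFieldTopology.Exports numFieldNormedType.Exports.
Local Open Scope classical_set_scope.
Local Open Scope card_scope.
Local Open Scope ring_scope.

(** The upper bounds come from the pair (spt mu, M_mu) of non-empty vertex
    sets. By definition a basic measure is determined by this pair. If two
    balanced measures share it, then so do all points of the segment between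
    them, since the transport cost is affine in mu: the segment consists of
    balanced measures, and the two ends lie in one component
    ([same_component]). So both counts are at most the number of pairs, and
    the pair of empty sets never occurs ([card_signatures]).

    The lower bounds come from complete multipartite graphs, where two vertices
    are at distance 1 across classes and 2 within a class. Hence
        T_mu(v) = 1 + mu(class of v) - 2 mu(v)     ([multipartite_cost]).
    In a class met by the support, a vertex without mass would cost strictly
    more than one with mass; so the support of a balanced measure is a union
    of classes, mu is constant on each of them, and
        T_mu(v) = 1 + (m - 2) mu(v)  for v in a support class of size m.
    As this cost is the same on all of the support, mu is determined by its
    support when no class has size 2 ([balanced_spt_inj]). There are therefore
    finitely many balanced measures, all of them are basic, and each is a
    component on its own.

    If moreover all classes have size at least 3, then every non-empty set S of
    classes carries a balanced measure: giving mass proportional to 1 / (m - 2)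
    to the vertices of each class of S makes the cost constant and larger than
    1 on S, while it is 1 elsewhere ([class_union_balanced]). With k classes
    this gives 2^k - 1 balanced measures. For k = n / 3 >= 2 the residues
    modulo k partition the n vertices into k classes of size at least 3. For
    smaller k one balanced measure is enough, and the uniform measure on the
    complete graph (all classes of size 1) is one. *)

(** * Counting with finite types *)

(** An invariant [s] in a finite type that separates the values of [f] bounds
    the size of the image of [f]: send each value to the invariant of a chosen
    preimage. *)
Lemma image_card_le_fin (X : choiceType) (U : Type) (T : finType)
    (f : X -> U) (D : set X) (s : X -> T) (B : {set T}) :
    (forall x, D x -> s x \in B) ->
    (forall x y, D x -> D y -> s x = s y -> f x = f y) ->
  exists2 k, f @` D #= `I_k & (k <= #|B|)%N.
Proof.
move=> sB sf.
have [->|/set0P[x0 Dx0]] := eqVneq D set0.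
  by exists 0%N; rewrite ?image_set0 ?II0.
pose r u := xget x0 [set x | D x /\ f x = u].
have rP u : (f @` D) u -> D (r u) /\ f (r u) = u.
  by case=> x Dx fx; apply: (@xgetPex _ x0 [set x | D x /\ f x = u]); exists x.
pose h u := index (s (r u)) (enum B).
have hinj : {in f @` D &, injective h}.
  move=> u v /set_mem /rP[Du fu] /set_mem /rP[Dv fv] huv.
  rewrite -fu -fv; apply: sf => //.
  by apply: (index_inj (s (r u)) _ _ huv); rewrite mem_enum; exact: sB.
have hle : f @` D #<= `I_#|B|.
  rewrite -(card_le_eql (inj_card_eq hinj)); apply: subset_card_le.
  move=> _ [u /rP[Du _] <-] /=.
  by rewrite /h cardE index_mem mem_enum; apply: sB.
have /finite_setP[k fDk] : finite_set (f @` D) by apply/finite_set_leP; exists #|B|.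
by exists k => //; rewrite -card_le_II -(card_le_eql fDk).
Qed.

Lemma card_le_inj_fin (T : finType) (U : Type) (B : {set T}) (g : T -> U)
    (A : set U) (k : nat) :
    (forall t, t \in B -> A (g t)) -> {in B &, injective g} -> A #= `I_k ->
  (#|B| <= k)%N.
Proof.
move=> gA ginj Ak.
have [->|[t0 t0B]] := set_0Vmem B; first by rewrite cards0.
pose h i := g (nth t0 (enum B) i).
have nthB i : (i < #|B|)%N -> nth t0 (enum B) i \in B.
  by move=> iB; rewrite -mem_enum mem_nth -?cardE.
have hinj : {in `I_#|B| &, injective h}.
  move=> i j /set_mem/= iB /set_mem/= jB /ginj; rewrite !nthB // => /(_ isT isT)/eqP.
  by rewrite nth_uniq ?enum_uniq -?cardE // => /eqP.
rewrite -card_le_II -(card_le_eqr Ak) -(card_le_eql (inj_card_eq hinj)).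
by apply: subset_card_le => _ [i iB <-]; apply/gA/nthB.
Qed.

(** Even when infinitely many indices occur, the cardinalities form a bounded
    non-empty set of natural numbers and so have a largest element. *)
Lemma is_max_card_exists (I U : Type) (A : I -> set U) (i0 : I) (l m : nat) :
    (forall i, exists2 k, A i #= `I_k & (k <= m)%N) ->
    (forall k, A i0 #= `I_k -> (l <= k)%N) ->
  exists b, is_max_card A b /\ (l <= b <= m)%N.
Proof.
move=> ub lb; pose P k := `[< exists i, A i #= `I_k >].
have Pub k : P k -> (k <= m)%N.
  move=> /asboolP[i Aik]; have [j Aij jm] := ub i.
  suff -> : k = j by [].
  by apply/card_eq_II; rewrite -(card_eql Aik).
have [k0 Ak0 _] := ub i0.
have exP : exists k, P k by exists k0; apply/asboolP; exists i0.
case: (ex_maxnP exP Pub) => b /asboolP[i Aib] bmax; exists b; split; first split.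
- move=> j; have [k Ajk _] := ub j; exists k => //.
  by apply: bmax; apply/asboolP; exists j.
- by exists i.
- rewrite Pub ?andbT; last by apply/asboolP; exists i.
  by apply: leq_trans (lb _ Ak0) (bmax _ _); apply/asboolP; exists i0.
Qed.

(** * Components of a finite subspace *)

(** Each point of the component is both closed and, as the complement of
    finitely many points, relatively open. *)
Lemma connected_component_finite (T : topologicalType) (A : set T) (x : T) :
  hausdorff_space T -> finite_set A -> A x -> connected_component A x = [set x].
Proof.
move=> hT finA Ax; have := hausdorff_accessible hT.
move=> /accessible_finite_set_closed cl.
set C := connected_component A x; have Cx : C x by exact: connected_component_refl.
apply: esym; apply: (component_connected (A := A) (x := x)).
- by exists x.
- exists (~` (A `\` [set x])).
    by rewrite openC; apply: cl; apply: finite_setD.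
  apply/seteqP; split => [_ ->|y [Cy]]; first by split => // -[_]; exact.
  by move=> /not_andP[[]|/contrapT//]; exact: connected_component_sub Cy.
- exists [set x]; first by apply: cl; apply: finite_set1.
  by apply/seteqP; split => [_ ->|y []].
Qed.

(** * Upper bounds: support and cost-maximizing set *)

Section Signature.
Variables (R : realType) (n : nat) (G : graph n).
Implicit Types mu nu : 'rV[R]_n.

Definition signature mu : {set 'I_n} * {set 'I_n} :=
  ([set v | `[< spt mu v >]]%SET, [set v | `[< cost_maximizers G mu v >]]%SET).

Lemma set_of_asbool_inj (P Q : set 'I_n) :
  [set v | `[< P v >]]%SET = [set v | `[< Q v >]]%SET -> P = Q.
Proof.
move=> /setP e; apply/seteqP; split=> v Hv; have := e v;
  rewrite !inE ?(asboolT Hv).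
- by move/esym/asboolP.
- by move/asboolP.
Qed.

Lemma signature_inj mu nu : signature mu = signature nu ->
  spt mu = spt nu /\ cost_maximizers G mu = cost_maximizers G nu.
Proof. by case=> /set_of_asbool_inj ? /set_of_asbool_inj. Qed.

Lemma spt_neq0 mu : prob_measure mu -> exists v, 0 < mu ord0 v.
Proof.
move=> [mu0 mu1]; apply: contrapT => /forallNP H; move: mu1.
rewrite big1 ?(@eqP _ 0 1) => [/eqP|v _]; first by rewrite eq_sym oner_eq0.
by apply/eqP; rewrite eq_le mu0 andbT leNgt; apply/negP.
Qed.

(** Excluding the pair of empty sets is what turns the count 2^(2n) of pairs of
    vertex sets into 2^(2n) - 1. *)
Lemma signature_proper mu : prob_measure mu ->
  signature mu \in [set~ (finset.set0, finset.set0)]%SET.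
Proof.
move=> /spt_neq0[v v0]; rewrite !inE xpair_eqE negb_and; apply/orP; left.
by apply/set0Pn; exists v; rewrite inE; apply/asboolP.
Qed.

Lemma card_signatures :
  #|[set~ (finset.set0 : {set 'I_n}, finset.set0 : {set 'I_n})]%SET|
  = (2 ^ (2 * n) - 1)%N.
Proof.
rewrite cardsC1 card_prod -cardsT -powersetT card_powerset cardsT card_ord.
by rewrite -expnD mul2n addnn subn1.
Qed.

Lemma transport_cost_segment mu nu t v :
  transport_cost G (mu + t *: (nu - mu)) v =
  (1 - t) * transport_cost G mu v + t * transport_cost G nu v.
Proof.
rewrite /transport_cost !mulr_sumr -big_split/=; apply: eq_bigr => u _.
by rewrite !mxE; ring.
Qed.

(** No point of the segment has mass outside the common support, and a vertex
    that maximizes the cost of both ends maximizes every convex combination of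
    the two costs. *)
Lemma balanced_segment mu nu t : 0 <= t <= 1 ->
    spt nu = spt mu -> cost_maximizers G nu = cost_maximizers G mu ->
  balanced G mu -> balanced G nu -> balanced G (mu + t *: (nu - mu)).
Proof.
move=> /andP[t0 t1] espt eM [[mu0 mu1] bmu] [[nu0 nu1] bnu].
have segE v : (mu + t *: (nu - mu)) ord0 v = (1 - t) * mu ord0 v + t * nu ord0 v.
  by rewrite !mxE; ring.
split; first split.
- by move=> v; rewrite segE addr_ge0 // mulr_ge0 // subr_ge0.
- under eq_bigr do rewrite segE.
  by rewrite big_split/= -!mulr_sumr mu1 nu1; ring.
- move=> v; rewrite /spt/= segE => vpos.
  have vmu : spt mu v.
    rewrite /spt/= lt_neqAle mu0 andbT; apply/eqP => muv0.
    have : ~ spt nu v by rewrite espt /spt/= -muv0 ltxx.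
    rewrite /spt/= => /negP; rewrite -leNgt => nuv0.
    move: vpos; rewrite -muv0 mulr0 add0r ltNge => /negP; apply.
    exact: mulr_ge0_le0.
  have Mmu := bmu _ vmu; have Mnu : cost_maximizers G nu v by rewrite eM.
  move=> u; rewrite !transport_cost_segment.
  by apply: lerD; apply: ler_wpM2l => //; rewrite subr_ge0.
Qed.

Lemma same_component mu nu :
    spt nu = spt mu -> cost_maximizers G nu = cost_maximizers G mu ->
    balanced G mu -> balanced G nu ->
  connected_component (balanced_measures G) mu =
  connected_component (balanced_measures G) nu.
Proof.
move=> espt eM bmu bnu; apply: same_connected_component.
pose seg (t : R) := mu + t *: (nu - mu).
exists (seg @` `[0, 1]).
  split.
  - by exists 0; rewrite /= ?in_itv/= ?lexx ?ler01 // /seg scale0r addr0.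
  - move=> _ [t /= t01 <-]; apply: balanced_segment => //.
  - apply: connected_continuous_connected; first exact: segment_connected.
    apply: continuous_subspaceT => t.
    by apply: cvgD; [exact: cvg_cst|apply: cvgZl; exact: cvg_id].
by exists 1; rewrite /= ?in_itv/= ?lexx ?ler01 // /seg scale1r addrC subrK.
Qed.

Lemma basic_card :
  exists2 k, @basic_balanced_measures R n G #= `I_k & (k <= 2 ^ (2 * n) - 1)%N.
Proof.
rewrite -card_signatures -[@basic_balanced_measures R n G]image_id.
apply: (image_card_le_fin (s := signature)).
  by move=> mu [[/signature_proper]].
move=> mu nu [[pmu bmu] _] [[pnu _] _] /signature_inj[es eM].
by apply: contrapT => /nesym ne; case: (bmu nu pnu ne).
Qed.

Lemma components_card :
  exists2 k, @balanced_components R n G #= `I_k & (k <= 2 ^ (2 * n) - 1)%N.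
Proof.
rewrite -card_signatures.
apply: (image_card_le_fin (s := signature)).
  by move=> mu [/signature_proper].
by move=> mu nu bmu bnu /signature_inj[es eM]; apply: same_component.
Qed.

End Signature.

(** * Short walks and distances *)

Lemma dist_eq n (G : graph n) (u v : 'I_n) (k : nat) :
  has_walk G u v k -> (forall j, (j < k)%N -> ~~ has_walk G u v j) ->
  dist G u v = k.
Proof.
move=> hk hmin; rewrite /dist; case: ex_minnP => m hm mmin.
apply/eqP; rewrite eqn_leq mmin //= leqNgt.
by apply/negP => /hmin; rewrite hm.
Qed.

Lemma has_walk0 n (G : graph n) (u v : 'I_n) : has_walk G u v 0 = (u == v).
Proof.
apply/existsP/idP => [[p]|uv]; first by rewrite tuple0.
by exists [tuple].
Qed.

Lemma has_walkS n (G : graph n) (u v : 'I_n) (k : nat) :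
  has_walk G u v k.+1 = [exists w, edge G u w && has_walk G w v k].
Proof.
apply/existsP/existsP => [[p]|[w /andP[uw /existsP[p /andP[wp pv]]]]].
  case/tupleP: p => w p /= /andP[/andP[uw wp] pv].
  by exists w; rewrite uw; apply/existsP; exists p; rewrite wp.
by exists [tuple of w :: p]; rewrite /= uw wp.
Qed.

Lemma has_walk1 n (G : graph n) (u v : 'I_n) : has_walk G u v 1 = edge G u v.
Proof.
rewrite has_walkS; apply/existsP/idP => [[w]|uv].
  by rewrite has_walk0 => /andP[uw /eqP <-].
by exists v; rewrite uv has_walk0 eqxx.
Qed.

(** * Balanced measures on complete multipartite graphs *)

Section Multipartite.
Variables (n : nat) (J : finType) (g : 'I_n -> J).
(* There are at least two classes: this is what makes the graph connected and
   puts two vertices of one class at distance 2. *)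
Hypothesis g_nonconst : forall u, exists w, g w != g u.

Let adj : rel 'I_n := fun u v => g u != g v.

Fact multipartite_sym : symmetric adj.
Proof. by move=> u v; rewrite /adj eq_sym. Qed.

Fact multipartite_irrefl : irreflexive adj.
Proof. by move=> u; rewrite /adj eqxx. Qed.

Fact multipartite_connected u v : connect adj u v.
Proof.
have [guv|guv] := eqVneq (g u) (g v); last exact: connect1.
have [w gw] := g_nonconst v.
apply: (connect_trans (y := w)); apply: connect1; rewrite /adj //.
by rewrite guv eq_sym.
Qed.

Definition multipartite : graph n :=
  Graph multipartite_sym multipartite_irrefl multipartite_connected.

Lemma multipartite_dist u v :
  dist multipartite u v = if u == v then 0%N else if g u == g v then 2 else 1%N.
Proof.
apply: dist_eq; have [<-|uv] := eqVneq u v; rewrite ?has_walk0 //.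
- have [guv|guv] := eqVneq (g u) (g v); last by rewrite has_walk1.
  have [w gw] := g_nonconst u; rewrite has_walkS; apply/existsP; exists w.
  by rewrite has_walk1 /= /adj eq_sym gw -guv.
- have [guv|guv] := eqVneq (g u) (g v) => -[|[|//]] // _.
  + by rewrite has_walk0.
  + by rewrite has_walk1 /= /adj guv eqxx.
  + by rewrite has_walk0.
Qed.

Variable R : realType.
Implicit Types mu nu : 'rV[R]_n.

Definition class_size (v : 'I_n) : nat := #|[set u | g u == g v]%SET|.

Definition class_mass mu (v : 'I_n) : R := \sum_(u | g u == g v) mu ord0 u.

(** The distance is 1 + [same class] - 2 [same vertex], also on the diagonal,
    where it reads 1 + 1 - 2 = 0. *)
Lemma multipartite_cost mu v : prob_measure mu ->
  transport_cost multipartite mu v = 1 + class_mass mu v - 2 * mu ord0 v.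
Proof.
move=> [_ mu1]; rewrite /transport_cost /class_mass -[X in X + _ - _]mu1.
have -> : 2 * mu ord0 v = \sum_(u | u == v) 2 * mu ord0 u by rewrite big_pred1_eq.
rewrite (big_mkcond (fun u => g u == g v)) (big_mkcond (fun u => u == v)) /=.
rewrite -big_split/= -sumrB; apply: eq_bigr => u _.
rewrite multipartite_dist.
by have [->|_] := eqVneq u v; rewrite ?eqxx; [|case: eqP => _]; ring.
Qed.

Lemma class_mass_const mu v c : (forall u, g u = g v -> mu ord0 u = c) ->
  class_mass mu v = (class_size v)%:R * c.
Proof.
move=> muc; rewrite /class_mass (eq_bigr (fun=> c)) => [|u /eqP]; last exact: muc.
by rewrite sumr_const /class_size cardsE mulr_natl.
Qed.

(** With w the mass of the class of v, a massless vertex u in that class would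
    have cost 1 + w against 1 + w - 2 mu(v), so v would not maximize the cost. *)
Lemma balanced_class_full mu u v : balanced multipartite mu ->
  0 < mu ord0 v -> g u = g v -> 0 < mu ord0 u.
Proof.
move=> [pmu bmu] v0 guv; have [mu0 mu1] := pmu.
rewrite lt_neqAle mu0 andbT; apply/eqP => muu.
have := bmu v v0 u; rewrite !multipartite_cost // /class_mass guv -muu.
by move: v0; lra.
Qed.

(** Both vertices lie in the support, so they have the same cost; as they share
    the class mass, they have the same mass. *)
Lemma balanced_class_uniform mu u v : balanced multipartite mu ->
  0 < mu ord0 v -> g u = g v -> mu ord0 u = mu ord0 v.
Proof.
move=> bal v0 guv; have u0 := balanced_class_full bal v0 guv.
have [pmu bmu] := bal.
have := bmu v v0 u; have := bmu u u0 v.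
by rewrite !multipartite_cost // /class_mass guv; lra.
Qed.

Lemma balanced_cost mu v : balanced multipartite mu -> 0 < mu ord0 v ->
  transport_cost multipartite mu v = 1 + ((class_size v)%:R - 2) * mu ord0 v.
Proof.
move=> bal v0; rewrite multipartite_cost; last by case: bal.
rewrite (@class_mass_const _ _ (mu ord0 v)); first by ring.
by move=> u; apply: balanced_class_uniform.
Qed.

(* For m = 2 the cost 1 + (m - 2) mu(v) does not depend on mu(v), so equality
   of the costs on the support would say nothing about the mass of the class. *)
Hypothesis size_neq2 : forall v, class_size v != 2.

(** For each of the two measures the product (m - 2) mu(v) is constant on the
    common support, with possibly different constants; as m - 2 is never zero
    this gives proportionality. *)
Lemma balanced_proportional mu nu : balanced multipartite mu ->
    balanced multipartite nu -> spt mu = spt nu ->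
  exists c, forall v, nu ord0 v = c * mu ord0 v.
Proof.
move=> bmu bnu espt; have [pmu Mmu] := bmu; have [pnu Mnu] := bnu.
have [v0 v0mu] := spt_neq0 pmu.
have toN v : 0 < mu ord0 v -> 0 < nu ord0 v.
  by move=> vmu; change (spt nu v); rewrite -espt.
have mu0 v : ~ 0 < mu ord0 v -> mu ord0 v = 0 /\ nu ord0 v = 0.
  move=> nv; have nv' : ~ spt nu v by rewrite -espt.
  by split; apply/eqP; rewrite eq_le ?(pmu.1 v) ?(pnu.1 v) andbT leNgt; apply/negP.
exists (nu ord0 v0 / mu ord0 v0) => v.
have [vmu|/negP/mu0[-> ->]] := boolP (0 < mu ord0 v);
  last by rewrite mulr0.
have vnu := toN _ vmu; have v0nu := toN _ v0mu.
pose m w : R := (class_size w)%:R - 2.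
have m0 w : m w != 0 by rewrite subr_eq0 eqr_nat.
have eqcost (la : 'rV[R]_n) : balanced multipartite la -> 0 < la ord0 v ->
    0 < la ord0 v0 -> m v * la ord0 v = m v0 * la ord0 v0.
  move=> bla lav lav0; have [_ Mla] := bla.
  have := Mla v lav v0; have := Mla v0 lav0 v.
  by rewrite !balanced_cost // /m; lra.
have e1 := eqcost mu bmu vmu v0mu; have e2 := eqcost nu bnu vnu v0nu.
apply: (mulfI (m0 v)); rewrite e2.
rewrite [RHS]mulrCA e1 mulrCA; congr (_ * _).
by rewrite divfK // gt_eqF.
Qed.

Lemma balanced_spt_inj mu nu : balanced multipartite mu ->
  balanced multipartite nu -> spt mu = spt nu -> mu = nu.
Proof.
move=> bmu bnu espt; have [c nuE] := balanced_proportional bmu bnu espt.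
have [[_ mu1] _] := bmu; have [[_ nu1] _] := bnu.
have c1 : c = 1.
  by move: nu1; under eq_bigr do rewrite nuE; rewrite -mulr_sumr mu1 mulr1.
by apply/rowP => v; rewrite nuE c1 mul1r.
Qed.

(** A measure with the support and cost-maximizing set of a balanced measure is
    balanced too, so determination by the support among balanced measures is
    enough. *)
Lemma multipartite_basic :
  @basic_balanced_measures R n multipartite = balanced_measures multipartite.
Proof.
apply/seteqP; split => [mu []//|mu bmu]; split => //; have [pmu Mmu] := bmu.
split => // nu pnu /nesym ne; apply/not_andP => -[es eM].
by apply/ne/balanced_spt_inj => //; split; rewrite // -es -eM.
Qed.

Lemma multipartite_balanced_finite :
  finite_set (@balanced_measures R n multipartite).
Proof.
rewrite -multipartite_basic.
by have [k ? _] := basic_card R multipartite; apply/finite_setP; exists k.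
Qed.

Lemma multipartite_components :
  @balanced_components R n multipartite #= @balanced_measures R n multipartite.
Proof.
have cc mu : balanced multipartite mu ->
    connected_component (balanced_measures multipartite) mu = [set mu].
  move=> bmu; apply: connected_component_finite => //.
    exact: multipartite_balanced_finite.
apply: inj_card_eq => mu nu /set_mem bmu /set_mem bnu; rewrite !cc //.
by move=> /seteqP[/(_ mu erefl)].
Qed.

Lemma multipartite_count_ge (T : finType) (B : {set T}) (mu : T -> 'rV[R]_n) :
    (forall t, t \in B -> balanced multipartite (mu t)) ->
    {in B &, injective mu} ->
  (forall k, @basic_balanced_measures R n multipartite #= `I_k -> (#|B| <= k)%N) /\
  (forall k, @balanced_components R n multipartite #= `I_k -> (#|B| <= k)%N).
Proof.
move=> bmu muinj; split=> k.
  by rewrite multipartite_basic; apply: card_le_inj_fin bmu muinj.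
by rewrite (card_eql multipartite_components); apply: card_le_inj_fin bmu muinj.
Qed.

End Multipartite.

(** * A balanced measure on each union of classes *)

Section ClassUnions.
Variables (R : realType) (n : nat) (J : finType) (g : 'I_n -> J).
Hypothesis g_nonconst : forall u, exists w, g w != g u.
Hypothesis g_surj : forall j, exists v, g v = j.
Hypothesis size_ge3 : forall v, (3 <= class_size g v)%N.

(* The mass of a vertex up to normalization, dictated by the constancy of
   (m - 2) mu(v) on the support. *)
Let rate (v : 'I_n) : R := ((class_size g v)%:R - 2)^-1.

Let rate_gt0 v : 0 < rate v.
Proof. by rewrite invr_gt0 subr_gt0 ltr_nat. Qed.

Definition class_union_measure (S : {set J}) : 'rV[R]_n :=
  \row_v (if g v \in S then rate v / \sum_(u | g u \in S) rate u else 0).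

Lemma class_union_total_gt0 (S : {set J}) : S != finset.set0 ->
  0 < \sum_(u | g u \in S) rate u.
Proof.
move=> /set0Pn[j jS]; have [v gv] := g_surj j.
rewrite (bigD1 v) ?gv //= ltr_pwDl // sumr_ge0 // => u _; exact: ltW.
Qed.

Lemma class_union_measure_gt0 (S : {set J}) v : S != finset.set0 ->
  (0 < class_union_measure S ord0 v) = (g v \in S).
Proof.
move=> /class_union_total_gt0 tot; rewrite mxE; case: ifP => _; last exact: ltxx.
by rewrite divr_gt0.
Qed.

Lemma class_union_measure_inj :
  {in [set~ finset.set0]%SET &, injective class_union_measure}.
Proof.
move=> S S'; rewrite !inE => S0 S'0 e; apply/setP => j.
have [v <-] := g_surj j.
by rewrite -(class_union_measure_gt0 v S0) -(class_union_measure_gt0 v S'0) e.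
Qed.

Lemma class_union_prob (S : {set J}) : S != finset.set0 ->
  prob_measure (class_union_measure S).
Proof.
move=> S0; have tot := class_union_total_gt0 S0; split=> [v|].
  by rewrite mxE; case: ifP => // _; rewrite divr_ge0 // ltW.
under eq_bigr do rewrite mxE.
by rewrite -big_mkcond /= -mulr_suml divff // gt_eqF.
Qed.

(** In S a class of size m has mass m times that of its vertices, so the excess
    over 1 is (m - 2) mu(v), in which m - 2 cancels. Outside S both the class
    mass and mu(v) vanish. *)
Lemma class_union_cost (S : {set J}) v : S != finset.set0 ->
  transport_cost (multipartite g_nonconst) (class_union_measure S) v =
  if g v \in S then 1 + (\sum_(u | g u \in S) rate u)^-1 else 1.
Proof.
move=> S0; have tot := class_union_total_gt0 S0.
rewrite multipartite_cost; last exact: class_union_prob.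
rewrite (@class_mass_const _ _ _ _ _ _ (class_union_measure S ord0 v)); last first.
  by move=> u guv; rewrite !mxE /rate /class_size guv.
rewrite mxE; case: ifP => _; last by ring.
rewrite -addrA -mulrBl mulrA divff ?mul1r // gt_eqF //.
by rewrite -invr_gt0; exact: rate_gt0.
Qed.

Lemma class_union_balanced (S : {set J}) : S != finset.set0 ->
  balanced (multipartite g_nonconst) (class_union_measure S).
Proof.
move=> S0; have tot := class_union_total_gt0 S0; split.
  exact: class_union_prob.
move=> v; rewrite /spt/= class_union_measure_gt0 // => gvS u.
rewrite !class_union_cost // gvS; case: ifP => // _.
by rewrite lerDl invr_ge0 ltW.
Qed.

End ClassUnions.

(** * Complete graphs and residue classes *)

Lemma complete_nonconst n : (2 <= n)%N -> forall u : 'I_n, exists w, id w != id u.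
Proof.
case: n => [|[|n]] // _ u; have [->|u0] := eqVneq u ord0; last first.
  by exists ord0; rewrite eq_sym.
by exists ord_max.
Qed.

Lemma complete_class_size n (v : 'I_n) : class_size id v = 1%N.
Proof. by rewrite /class_size -(cards1 v); apply: eq_card => u; rewrite !inE. Qed.

Lemma complete_uniform_balanced (R : realType) n (hn : (2 <= n)%N) :
  balanced (multipartite (complete_nonconst hn)) (const_mx n%:R^-1 : 'rV[R]_n).
Proof.
have pmu : prob_measure (const_mx n%:R^-1 : 'rV[R]_n).
  split=> [v|]; first by rewrite mxE invr_ge0 ler0n.
  under eq_bigr do rewrite mxE.
  rewrite sumr_const card_ord -[LHS]mulr_natl divff // pnatr_eq0.
  by case: n hn.
split=> // v _ u; rewrite !multipartite_cost //.
rewrite !(@class_mass_const _ _ _ _ _ _ n%:R^-1) ?complete_class_size ?mxE //.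
  by move=> w _; rewrite mxE.
by move=> w _; rewrite mxE.
Qed.

Section Residues.
(* The number of classes is k + 2, so that it is at least 2. *)
Variables (n k : nat).
Hypothesis kn : (3 * k.+2 <= n)%N.

Definition residue (v : 'I_n) : 'I_k.+2 := inord (v %% k.+2).

Let residueE v : residue v = (v %% k.+2)%N :> nat.
Proof. by rewrite inordK // ltn_pmod. Qed.

(* Three vertices j, j + k', j + 2k' in the class of j, where k' = k + 2 is the
   number of classes. *)
Let rep (j : 'I_k.+2) (i : 'I_3) : 'I_n.
Proof.
exists (i * k.+2 + j)%N; apply: leq_trans kn.
have le2 : (i <= 2)%N by case: i.
by rewrite -addnS (mulnDl 2 1) mul1n leq_add // leq_mul2r le2 orbT.
Defined.

Let residue_rep j i : residue (rep j i) = j.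
Proof. by apply: ord_inj; rewrite residueE /= modnMDl modn_small. Qed.

Lemma residue_surj j : exists v, residue v = j.
Proof. by exists (rep j ord0); rewrite residue_rep. Qed.

Lemma residue_nonconst u : exists w, residue w != residue u.
Proof.
have [w hw] := @complete_nonconst k.+2 isT (residue u).
by have [v gv] := residue_surj w; exists v; rewrite gv.
Qed.

Lemma residue_size_ge3 v : (3 <= class_size residue v)%N.
Proof.
have inj : injective (rep (residue v)).
  by move=> i i' /(congr1 val)/= /addIn/eqP; rewrite eqn_pmul2r // => /eqP/val_inj.
have := card_imset 'I_3 inj; rewrite card_ord => <-; apply: subset_leq_card.
by apply/fintype.subsetP => _ /imsetP[i _ ->]; rewrite inE residue_rep.
Qed.

End Residues.

(** * The bounds *)

Theorem proposition1p5 (R : realType) (n : nat) (hn : (2 <= n)%N) :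
  (exists b : nat, is_b R n b /\ (2 ^ (n %/ 3) - 1 <= b <= 2 ^ (2 * n) - 1)%N) /\
  (exists c : nat, is_c R n c /\ (2 ^ (n %/ 3) - 1 <= c <= 2 ^ (2 * n) - 1)%N).
Proof.
suff [G [bG cG]] : exists G : graph n,
    (forall k, @basic_balanced_measures R n G #= `I_k ->
      (2 ^ (n %/ 3) - 1 <= k)%N) /\
    (forall k, @balanced_components R n G #= `I_k ->
      (2 ^ (n %/ 3) - 1 <= k)%N).
  split; apply: is_max_card_exists; [|exact: bG| |exact: cG] => i.
  - exact: basic_card.
  - exact: components_card.
(* For n < 6 the bound is at most 1. Residue classes would fail for n = 3, since
   a single class has no edges. *)
have [k1|] := leqP (n %/ 3)%N 1.
  have size_neq2 v : class_size (@id 'I_n) v != 2 by rewrite complete_class_size.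
  exists (multipartite (complete_nonconst hn)).
  have := @multipartite_count_ge _ _ _ (complete_nonconst hn) R size_neq2
    unit [set: unit]%SET (fun=> const_mx n%:R^-1).
  rewrite cardsT card_unit => -[].
  - by move=> _ _; apply: complete_uniform_balanced.
  - by case=> [] [].
  have le1 : (2 ^ (n %/ 3) - 1 <= 1)%N by case: (n %/ 3)%N k1 => [|[]].
  by move=> bge cge; split=> k /[dup] h; [move/bge|move/cge]; exact: leq_trans.
case E : (n %/ 3)%N => [|[|k]] // _.
have kn : (3 * k.+2 <= n)%N by rewrite -E mulnC leq_divM.
have size_neq2 v : class_size (@residue n k) v != 2.
  by rewrite gtn_eqF // residue_size_ge3.
exists (multipartite (residue_nonconst kn)).
have -> : (2 ^ k.+2 - 1)%N = #|[set~ finset.set0 : {set 'I_k.+2}]%SET|.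
  by rewrite cardsC1 -cardsT -powersetT card_powerset cardsT card_ord subn1.
apply: (@multipartite_count_ge _ _ _ (residue_nonconst kn) R size_neq2 _ _
  (class_union_measure R (@residue n k))).
  move=> S; rewrite !inE => S0; apply: class_union_balanced => //.
  - exact: residue_surj.
  - exact: residue_size_ge3.
apply: class_union_measure_inj; [exact: residue_surj|exact: residue_size_ge3].
Qed.
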